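(* Let $D\subset\mathscr{P}_2(\mathbb{R}^d)$ be bounded, $D^{(1)}:=\{\nu:\operatorname{dist}(\nu,D)\le1\}$, and let $\phi\in\operatorname{UC}([0,T]\times D^{(1)})$ with $c_0:=\sup\{|\phi(t,\nu)|:t\in[0,T],\nu\in D^{(1)}\}<\infty$. Let $s\in(0,T)$, $\mu\in D$, $\varepsilon>0$, $\varkappa>0$, let $(t^\varepsilon_\varkappa,\nu^\varepsilon_\varkappa)$ be an Ekeland pair for $(s,\mu)$ (see context), let $\pi^\varepsilon_\varkappa$ be an optimal plan between $\mu$ and $\nu^\varepsilon_\varkappa$, and put $$a^\varepsilon_\varkappa:=\varkappa^{-2}(s-t^\varepsilon_\varkappa),\qquad\gamma^\varepsilon_\varkappa:=(\mathrm{p}^2,\varkappa^{-2}(\mathrm{p}^1-\mathrm{p}^2)^\top)\sharp\pi^\varepsilon_\varkappa.$$ If $\varrho_1(\varkappa)<\min\{1,s,T-s\}$, then $$(a^\varepsilon_\varkappa,\gamma^\varepsilon_\varkappa)\in\partial^-_{P,\varepsilon}\phi(t^\varepsilon_\varkappa,\nu^\varepsilon_\varkappa).$$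
   Context: $\mathscr{P}_2(X)$ is the space of Borel probability measures on $X$ with finite second moment, with the 2-Wasserstein metric $W_2$; $T>0$. $\mathbb{R}^{d*}$ denotes row vectors, $\top$ transpose; $h\sharp m$ push-forward; $\mathrm{p}^i,\mathrm{p}^{i,j}$ coordinate projections; $\|\pi\|:=(\int|x_1-x_2|^2\pi(d(x_1,x_2)))^{1/2}$. $\operatorname{UC}(X)$: real functions on $X$ uniformly continuous on each bounded subset. $[0,T]\times\mathscr{P}_2(\mathbb{R}^d)$ carries the metric $(|t-s|^2+W_2^2(\nu,\mu))^{1/2}$, closed balls $\mathbb{B}_\alpha$. **Ekeland pair** for $(s,\mu)$ with parameters $\varkappa,\varepsilon>0$: a pair $(t^\varepsilon_\varkappa,\nu^\varepsilon_\varkappa)\in[0,T]\times D^{(1)}$ (existing by Ekeland's variational principle) such that $$\phi(t^\varepsilon_\varkappa,\nu^\varepsilon_\varkappa)+\tfrac1{2\varkappa^2}\big(|t^\varepsilon_\varkappa-s|^2+W_2^2(\mu,\nu^\varepsilon_\varkappa)\big)+\varepsilon\big(|s-t^\varepsilon_\varkappa|^2+W_2^2(\mu,\nu^\varepsilon_\varkappa)\big)^{1/2}\le\phi(s,\mu)$$ and, for all $(t,\nu)\in[0,T]\times D^{(1)}$, $$\phi(t,\nu)+\tfrac1{2\varkappa^2}\big(|t-s|^2+W_2^2(\mu,\nu)\big)+\varepsilon\big(|t-t^\varepsilon_\varkappa|^2+W_2^2(\nu,\nu^\varepsilon_\varkappa)\big)^{1/2}\ge\phi(t^\varepsilon_\varkappa,\nu^\varepsilon_\varkappa)+\tfrac1{2\varkappa^2}\big(|t^\varepsilon_\varkappa-s|^2+W_2^2(\mu,\nu^\varepsilon_\varkappa)\big).$$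 **Modulus and $\varrho_1$.** $\omega(\kappa):=\sup\{|\phi(t',\nu')-\phi(t'',\nu'')|: t',t''\in[0,T],\ \nu',\nu''\in D^{(1)},\ |t'-t''|^2+W_2^2(\nu',\nu'')\le\kappa^2\}$ and $\varrho_1(\kappa):=\min\{\kappa\sqrt2\,(\omega(\kappa\sqrt{2c_0}))^{1/2},\ \kappa\sqrt{2c_0}\}$. **Proximal subdifferential.** For $(s,\mu)$ in the interior of the domain of $\phi$, $\partial^-_{P,\varepsilon}\phi(s,\mu)$ is the set of $(a,\gamma)\in\mathbb{R}\times\mathscr{P}_2(\mathbb{R}^d\times\mathbb{R}^{d*})$ for which there are $\alpha>0,\sigma\ge0$ such that for every $(t,\nu)\in\mathbb{B}_\alpha(s,\mu)$ and every $\beta\in\mathscr{P}_2(\mathbb{R}^d\times\mathbb{R}^d\times\mathbb{R}^{d*})$ with $\mathrm{p}^{1,3}\sharp\beta=\gamma$, $\mathrm{p}^2\sharp\beta=\nu$: $$\phi(t,\nu)-\phi(s,\mu)\ge a(t-s)+\int q(x'-x)\beta(d(x,x',q))-\sigma\big((t-s)^2+\|\mathrm{p}^{1,2}\sharp\beta\|^2\big)-\varepsilon\big(|t-s|^2+W_2^2(\nu,\mu)\big)^{1/2}.$$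
   Formalization: The Ekeland point can lie on the boundary of the domain of φ despite the bound on ϱ₁, where the subdifferential is undefined; the formal one tests only (t,ν) in the ball that lie in [0,T]×D^(1) and does not assert interiority; at interior points it agrees with the paper's. *)

(* Defs.v *)
From HB Require Import structures.
From mathcomp Require Import all_boot all_order all_algebra.
From mathcomp Require Import all_classical all_reals all_analysis.
From mathcomp Require Import measurable_realfun giry lra.

Set Implicit Arguments.
Unset Strict Implicit.
Unset Printing Implicit Defensive.

Import Order.TTheory GRing.Theory Num.Theory.
Import numFieldNormedType.Exports.

Local Open Scope classical_set_scope.
Local Open Scope ring_scope.

(* Borel sigma-algebra on matrices. *)
HB.instance Definition _ (R : realType) (m n : nat) :=
  @isMeasurable.Build (sigma_display (@open 'M[R]_(m, n))) 'M[R]_(m, n)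
    <<s @open 'M[R]_(m, n) >> (@sigma_algebra0 _ setT _)
    (@sigma_algebraC _ _) (@sigma_algebra_bigcup _ setT _).

Section matrix_measurability.
Context {R : realType} {m n : nat}.

Lemma measurable_coord (i : 'I_m) (j : 'I_n) :
  measurable_fun setT (fun x : 'M[R]_(m, n) => x i j).
Proof.
apply: (measurability _ (RGenOpens.measurableE R)).
move=> _ [_ [a [b ->]] <-]; rewrite setTI.
apply: sub_sigma_algebra.
by apply: open_comp => [x _|]; [exact: coord_continuous|exact: interval_open].
Qed.

Let box (c : 'M[rat]_(m, n)) (r : rat) : set 'M[R]_(m, n) :=
  [set y | forall i j, `|ratr (c i j) - y i j| < ratr r].

Let open_boxes (U : set 'M[R]_(m, n)) : open U ->
  U = \bigcup_(q : 'M[rat]_(m, n) * rat)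
        (if `[< box q.1 q.2 `<=` U >] then box q.1 q.2 else set0).
Proof.
move=> oU; apply/seteqP; split=> [x Ux|x [[c r] _] /=]; last first.
  by case: ifPn => // /asboolP; apply.
have /nbhs_ballP[e /= e0 xeU] : nbhs x U by exact: open_nbhs_nbhs.
have /rat_in_itvoo[r] : 0 < e / 2 by rewrite divr_gt0.
rewrite in_itv/= => /andP[r0 re].
have cP i j : {q : rat | `|ratr q - x i j| < ratr r}.
  apply: cid; have /rat_in_itvoo[q] : x i j - ratr r < x i j + ratr r by lra.
  by rewrite in_itv/= => /andP[? ?]; exists q; rewrite ltr_norml; lra.
exists (\matrix_(i, j) sval (cP i j), r) => //=.
rewrite ifT; first by move=> i j; rewrite mxE; exact: svalP (cP i j).
apply/asboolP => y yc; apply: xeU; split=> // i j.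
move: (yc i j) (svalP (cP i j)); rewrite /ball/= mxE.
rewrite !ltr_norml; lra.
Qed.

Lemma measurable_fun_mx d (T : measurableType d) (f : T -> 'M[R]_(m, n)) :
  (forall i j, measurable_fun setT (fun x => f x i j)) ->
  measurable_fun setT f.
Proof.
move=> mf; apply: (measurability (@open 'M[R]_(m, n))) => // _ [U oU <-].
rewrite setTI (open_boxes oU) preimage_bigcup.
apply: countable_bigcupT_measurable => [|[c r]]; first exact: countableP.
case: ifPn => _; last by rewrite preimage_set0.
have -> : f @^-1` box c r = ~` \bigcup_(ij : 'I_m * 'I_n)
    ((fun x => f x ij.1 ij.2) @^-1`
       ~` [set z | `|ratr (c ij.1 ij.2) - z| < ratr r]).
  apply/seteqP; split=> x /=; rewrite /box/=.
    by move=> H [[i j] _]; apply; exact: H.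
  by move=> H i j; apply: contrapT => Hn; apply: H; exists (i, j).
apply: measurableC; apply: countable_bigcupT_measurable => [|[i j]] /=.
  exact: countableP.
rewrite -[X in measurable X]setTI; apply: mf => //; apply: measurableC.
rewrite (_ : [set z | _] =
  `](ratr (c i j) - ratr r), (ratr (c i j) + ratr r)[%classic).
  exact: measurable_itv.
by apply/seteqP; split=> z; rewrite /= in_itv/= ltr_norml; lra.
Qed.

End matrix_measurability.

Definition push {dX dY} {X : measurableType dX} {Y : measurableType dY}
  {R : realType} (f : {mfun X >-> Y}) (m : probability X R) :
  probability Y R := distribution m f.

Section wasserstein.
Context {R : realType} {d : nat}.

(* Points are columns and dual vectors are rows; |.| is the Euclidean norm,
   whereas `|x| on matrices would be the sup norm. *)
Local Notation E := 'cV[R]_d.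
Local Notation E' := 'rV[R]_d.

Definition sqnorm {m n} (x : 'M[R]_(m, n)) : R := \sum_i \sum_j x i j ^+ 2.

Definition finite_second_moment {dX} {X : measurableType dX} (sq : X -> R)
    (m : probability X R) : Prop :=
  (\int[m]_x (sq x)%:E < +oo)%E.

Definition P2 : set (probability E R) := finite_second_moment sqnorm.

Definition P2_dual : set (probability (E * E')%type R) :=
  finite_second_moment (fun z => sqnorm z.1 + sqnorm z.2).

Definition P2_triple : set (probability (E * E * E')%type R) :=
  finite_second_moment
    (fun z => sqnorm z.1.1 + sqnorm z.1.2 + sqnorm z.2).

Definition plan_proj1 : E * E -> E := fst.
Definition plan_proj2 : E * E -> E := snd.
Definition proj2_triple (z : E * E * E') : E := z.1.2.
Definition proj12_triple (z : E * E * E') : E * E := (z.1.1, z.1.2).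
Definition proj13_triple (z : E * E * E') : E * E' := (z.1.1, z.2).

(* (p^2, kappa^-2 (p^1 - p^2)^T) *)
Definition dual_map (kappa : R) (z : E * E) : E * E' :=
  (z.2, kappa ^- 2 *: (z.1 - z.2)^T).

Let measurable_plan_proj1 : measurable_fun setT plan_proj1.
Proof. exact: measurable_fst. Qed.
HB.instance Definition _ := isMeasurableFun.Build _ _ _ _ _ measurable_plan_proj1.

Let measurable_plan_proj2 : measurable_fun setT plan_proj2.
Proof. exact: measurable_snd. Qed.
HB.instance Definition _ := isMeasurableFun.Build _ _ _ _ _ measurable_plan_proj2.

Let measurable_proj2_triple : measurable_fun setT proj2_triple.
Proof. exact: (measurableT_comp measurable_snd measurable_fst). Qed.
HB.instance Definition _ :=
  isMeasurableFun.Build _ _ _ _ _ measurable_proj2_triple.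

Let measurable_plan_proj12_triple : measurable_fun setT proj12_triple.
Proof.
apply: measurable_fun_pair; last exact: measurable_proj2_triple.
exact: (measurableT_comp measurable_fst measurable_fst).
Qed.
HB.instance Definition _ :=
  isMeasurableFun.Build _ _ _ _ _ measurable_plan_proj12_triple.

Let measurable_plan_proj13_triple : measurable_fun setT proj13_triple.
Proof.
apply: measurable_fun_pair; last exact: measurable_snd.
exact: (measurableT_comp measurable_fst measurable_fst).
Qed.
HB.instance Definition _ :=
  isMeasurableFun.Build _ _ _ _ _ measurable_plan_proj13_triple.

Let measurable_dual_map kappa : measurable_fun setT (dual_map kappa).
Proof.
apply: measurable_fun_pair; first exact: measurable_snd.
apply: measurable_fun_mx => i j.
rewrite (_ : (fun _ => _) =
    (fun z : E * E => kappa ^- 2 * (z.1 j i - z.2 j i))); last first.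
  by apply/funext => z; rewrite !mxE.
apply: measurable_funM => //; apply: measurable_funB.
- exact: (measurableT_comp (measurable_coord j i) measurable_fst).
- exact: (measurableT_comp (measurable_coord j i) measurable_snd).
Qed.
HB.instance Definition _ kappa :=
  isMeasurableFun.Build _ _ _ _ _ (measurable_dual_map kappa).

(* Equality of measures is [measure_eq] (agreement on measurable sets), because
   a library measure also carries irrelevant values on non-measurable sets. *)
Definition plan (mu nu : probability E R) : set (probability (E * E)%type R) :=
  [set pi | measure_eq (push plan_proj1 pi) mu /\
            measure_eq (push plan_proj2 pi) nu].

(* The integral is finite, so that [fine] is harmless, as soon as the marginals
   of pi are in P2. *)
Definition plan_norm (pi : probability (E * E)%type R) : R :=
  Num.sqrt (fine (\int[pi]_z (sqnorm (z.1 - z.2))%:E)).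

Definition W2 (mu nu : probability E R) : R :=
  inf [set plan_norm pi | pi in plan mu nu].

Definition optimal_plan (mu nu : probability E R) :
    set (probability (E * E)%type R) :=
  [set pi | plan mu nu pi /\ plan_norm pi = W2 mu nu].

Definition bounded_for {Z : Type} (dist : Z -> Z -> R) (A : set Z) : Prop :=
  exists r, forall x y, A x -> A y -> dist x y <= r.

Definition unit_enlargement (D : set (probability E R)) :
    set (probability E R) :=
  [set nu | P2 nu /\ inf [set W2 nu m | m in D] <= 1].

Definition tdist (z w : R * probability E R) : R :=
  Num.sqrt (`|z.1 - w.1| ^+ 2 + W2 z.2 w.2 ^+ 2).

(* Closed ball of [0, T] x P2. *)
Definition tball (T : R) (z : R * probability E R) (alpha : R) :
    set (R * probability E R) :=
  [set w | 0 <= w.1 <= T /\ P2 w.2 /\ tdist w z <= alpha].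

Definition cylinder (T : R) (A : set (probability E R)) :
    set (R * probability E R) :=
  [set z | 0 <= z.1 <= T /\ A z.2].

(* A function on a set Dom is represented by a total function of which only
   the values on Dom are ever used. *)
Implicit Types (Dom : set (R * probability E R))
  (phi : R * probability E R -> R).

Definition UC Dom phi : Prop :=
  forall B, B `<=` Dom -> bounded_for tdist B ->
  forall e, 0 < e -> exists delta, 0 < delta /\
    forall z w, B z -> B w -> tdist z w < delta -> `|phi z - phi w| < e.

Definition abs_values Dom phi : set R := [set `|phi z| | z in Dom].

Definition modulus Dom phi (k : R) : R :=
  sup [set r | exists t' nu' t'' nu'',
    [/\ Dom (t', nu'), Dom (t'', nu''),
        `|t' - t''| ^+ 2 + W2 nu' nu'' ^+ 2 <= k ^+ 2
      & r = `|phi (t', nu') - phi (t'', nu'')|]].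

Definition rho1 Dom phi (k : R) : R :=
  let c0 := sup (abs_values Dom phi) in
  Num.min
    (k * Num.sqrt 2 * Num.sqrt (modulus Dom phi (k * Num.sqrt (2 * c0))))
    (k * Num.sqrt (2 * c0)).

Definition ekeland_pair Dom phi (s : R) (mu : probability E R)
    (kappa eps : R) (te : R) (nue : probability E R) : Prop :=
  [/\ Dom (te, nue),
      phi (te, nue)
        + (2 * kappa ^+ 2)^-1 * (`|te - s| ^+ 2 + W2 mu nue ^+ 2)
        + eps * Num.sqrt (`|s - te| ^+ 2 + W2 mu nue ^+ 2)
      <= phi (s, mu)
    & forall t nu, Dom (t, nu) ->
      phi (t, nu)
        + (2 * kappa ^+ 2)^-1 * (`|t - s| ^+ 2 + W2 mu nu ^+ 2)
        + eps * Num.sqrt (`|t - te| ^+ 2 + W2 nu nue ^+ 2)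
      >= phi (te, nue)
        + (2 * kappa ^+ 2)^-1 * (`|te - s| ^+ 2 + W2 mu nue ^+ 2)].

Definition prox_inequality phi (eps s : R) (mu : probability E R)
    (a : R) (gamma : probability (E * E')%type R) (sigma t : R)
    (nu : probability E R) : Prop :=
  forall beta : probability (E * E * E')%type R, P2_triple beta ->
    measure_eq (push proj13_triple beta) gamma ->
    measure_eq (push proj2_triple beta) nu ->
    phi (t, nu) - phi (s, mu) >=
      a * (t - s)
      + \int[beta]_z ((z.2 *m (z.1.2 - z.1.1)) ord0 ord0)
      - sigma * ((t - s) ^+ 2
                 + plan_norm (push proj12_triple beta) ^+ 2)
      - eps * Num.sqrt (`|t - s| ^+ 2 + W2 nu mu ^+ 2).

(* phi lives on Dom, so (t, nu) ranges over the points of Dom in the ball. If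
   (s, mu) is interior to Dom the restriction is void, see
   [prox_subdiff_interior]; membership does not assert that (s, mu) is
   interior. *)
Definition prox_subdiff (T : R) Dom phi (eps s : R) (mu : probability E R) :
    set (R * probability (E * E')%type R) :=
  [set ag | P2_dual ag.2 /\
    exists alpha sigma, [/\ 0 < alpha, 0 <= sigma &
      forall t nu, tball T (s, mu) alpha (t, nu) -> Dom (t, nu) ->
        prox_inequality phi eps s mu ag.1 ag.2 sigma t nu]].

Lemma prox_subdiff_interior (T : R) Dom phi eps s mu a gamma :
  (exists2 r, 0 < r & tball T (s, mu) r `<=` Dom) ->
  prox_subdiff T Dom phi eps s mu (a, gamma) <->
  (P2_dual gamma /\
    exists alpha sigma, [/\ 0 < alpha, 0 <= sigma,
      tball T (s, mu) alpha `<=` Dom &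
      forall t nu, tball T (s, mu) alpha (t, nu) ->
        prox_inequality phi eps s mu a gamma sigma t nu]).
Proof.
move=> [r r0 rD]; split=> -[g2 [al [si [al0 si0]]]]; last first.
  by move=> _ H; split=> //; exists al, si; split=> // t nu /H.
move=> H; split=> //; exists (Num.min al r), si.
have sub w : tball T (s, mu) (Num.min al r) w ->
    tball T (s, mu) al w /\ tball T (s, mu) r w.
  by move=> [? [?]]; rewrite le_min => /andP[? ?].
split=> //; first by rewrite lt_min al0.
  by move=> w /sub[_ /rD].
by move=> t nu /sub[ball_al /rD]; exact: H.
Qed.

End wasserstein.

(* Main.v *)
Require Import Defs.
From HB Require Import structures.
From mathcomp Require Import all_boot all_order all_algebra.
From mathcomp Require Import all_classical all_reals all_analysis.
From mathcomp Require Import measurable_realfun giry ring lra.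

(** For a competitor [beta], with points [(x, x', q)], the law of
    [(x + kappa^2 q^T, x')] is a plan between [mu] and [nu], because the law of
    [(x, q)] recovers the optimal plan [pie] through [y = x + kappa^2 q^T].
    Expanding its cost gives
    [W2(mu, nu)^2 <= W2(mu, nue)^2 - 2 kappa^2 \int q (x' - x) + |p^{1,2} beta|^2],
    and the second Ekeland inequality turns this into the proximal inequality
    with [sigma = (2 kappa^2)^-1], on all of the domain of [phi]. *)

Import Order.TTheory GRing.Theory Num.Theory.
Import numFieldNormedType.Exports.

Local Open Scope classical_set_scope.
Local Open Scope ring_scope.

Set Implicit Arguments.
Unset Strict Implicit.
Unset Printing Implicit Defensive.

(** * Euclidean norm: expansion, bounds and measurability *)

Section sqnorm_theory.
Context {R : realType}.

Lemma sqnorm_ge0 {m n} (x : 'M[R]_(m, n)) : 0 <= sqnorm x.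
Proof. by apply: sumr_ge0 => i _; apply: sumr_ge0 => j _; exact: sqr_ge0. Qed.

Lemma sqnormZ {m n} (c : R) (x : 'M[R]_(m, n)) :
  sqnorm (c *: x) = c ^+ 2 * sqnorm x.
Proof.
rewrite /sqnorm mulr_sumr; apply: eq_bigr => i _.
by rewrite mulr_sumr; apply: eq_bigr => j _; rewrite mxE exprMn.
Qed.

Lemma sqnorm_tr {m n} (x : 'M[R]_(m, n)) : sqnorm x^T = sqnorm x.
Proof.
rewrite /sqnorm exchange_big; apply: eq_bigr => i _.
by apply: eq_bigr => j _; rewrite mxE.
Qed.

Lemma sqnormB_le {m n} (x y : 'M[R]_(m, n)) :
  sqnorm (x - y) <= 2 * (sqnorm x + sqnorm y).
Proof.
rewrite /sqnorm -big_split/= mulr_sumr; apply: ler_sum => i _.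
rewrite -big_split/= mulr_sumr; apply: ler_sum => j _.
by rewrite !mxE; have := sqr_ge0 (x i j + y i j); lra.
Qed.

(** Used with [c = kappa ^+ 2] for the cost of the shifted plan, and with [c = 1] and [c = -1] to
    bound the pairing. *)
Lemma sqnorm_shift {d} (c : R) (x x' : 'cV[R]_d) (q : 'rV[R]_d) :
  sqnorm (x + c *: q^T - x') =
  c ^+ 2 * sqnorm q - 2 * c * (q *m (x' - x)) ord0 ord0 + sqnorm (x - x').
Proof.
rewrite -(sqnorm_tr q) /sqnorm !mxE !mulr_sumr -sumrB -big_split/=.
by apply: eq_bigr => i _; rewrite !big_ord1 !mxE; ring.
Qed.

(** Nonnegativity of the squared norms of [x - x' + q^T] and [x - x' - q^T] bounds twice the
    pairing, up to sign, by [sqnorm q + sqnorm (x - x')]. The right-hand side is the integrand of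
    [P2_triple]. *)
Lemma normr_pairing_le {d} (x x' : 'cV[R]_d) (q : 'rV[R]_d) :
  `|(q *m (x' - x)) ord0 ord0| <= sqnorm x + sqnorm x' + sqnorm q.
Proof.
have := sqnormB_le x x'; have := sqnorm_ge0 q.
have := sqnorm_ge0 (x + 1 *: q^T - x'); rewrite sqnorm_shift.
have := sqnorm_ge0 (x + (-1) *: q^T - x'); rewrite sqnorm_shift.
by rewrite ler_norml; lra.
Qed.

Lemma measurable_sqnorm {m n} :
  measurable_fun setT (sqnorm : 'M[R]_(m, n) -> R).
Proof.
apply: measurable_sum => i; apply: measurable_sum => j.
by apply: measurable_funX; exact: measurable_coord.
Qed.

Lemma measurable_sqnormB {d} :
  measurable_fun setT
    (fun z : 'cV[R]_d * 'cV[R]_d => sqnorm (z.1 - z.2)).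
Proof.
apply: (measurableT_comp measurable_sqnorm); apply: measurable_fun_mx => i j.
under eq_fun do rewrite !mxE; apply: measurable_funB.
- exact: (measurableT_comp (measurable_coord i j) measurable_fst).
- exact: (measurableT_comp (measurable_coord i j) measurable_snd).
Qed.

End sqnorm_theory.

(** * Domination and change of variables for integrals *)

Section integration.
Context {R : realType} {d1 d2} {X : measurableType d1} {Y : measurableType d2}.

Lemma integrable_dominated (P : probability X R) (c : R) (f g : X -> R) :
  measurable_fun setT f -> measurable_fun setT g -> 0 <= c ->
  (forall x, 0 <= g x) -> (forall x, `|f x| <= c * g x) ->
  finite_second_moment g P -> P.-integrable setT (EFin \o f).
Proof.
move=> mf mg c0 g0 fg gfin.
have ig : P.-integrable setT (EFin \o g).
  apply/integrableP; split; first exact/measurable_EFinP.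
  apply: le_lt_trans gfin; rewrite le_eqVlt; apply/orP; left; apply/eqP.
  by apply: eq_integral => x _; rewrite /= ger0_norm.
apply: (le_integrable measurableT _ _ (integrableZl measurableT c ig)).
- exact/measurable_EFinP.
- by move=> x _ /=; rewrite lee_fin [leRHS]ger0_norm ?mulr_ge0.
Qed.

(** For nonnegative [g] the change of variables holds even when the integral is infinite. Only
    squared norms are transported this way below, never the signed pairing. *)
Lemma Rintegral_push (f : {mfun X >-> Y}) (P : probability X R) (g : Y -> R) :
  measurable_fun setT g -> (forall y, 0 <= g y) ->
  \int[push f P]_y g y = \int[P]_x g (f x).
Proof.
move=> mg g0; rewrite /Rintegral /push ge0_integral_distribution//.
exact/measurable_EFinP.
Qed.

Lemma Rintegral_measure_eq (P Q : probability X R) (g : X -> R) :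
  measure_eq P Q -> \int[P]_x g x = \int[Q]_x g x.
Proof.
move=> PQ; congr fine; apply: eq_measure_integral => A mA _; exact: PQ.
Qed.

Lemma finite_second_moment_push (f : {mfun X >-> Y}) (P : probability X R)
    (Q : probability Y R) (g : Y -> R) :
  measurable_fun setT g -> (forall y, 0 <= g y) -> measure_eq (push f P) Q ->
  finite_second_moment g Q <-> finite_second_moment (g \o f) P.
Proof.
move=> mg g0 PQ; rewrite /finite_second_moment.
rewrite (_ : (\int[Q]_y (g y)%:E)%E = (\int[P]_x (g (f x))%:E)%E)//.
transitivity (\int[push f P]_y (g y)%:E)%E.
  by apply: eq_measure_integral => A mA _; rewrite [RHS]PQ.
rewrite /push ge0_integral_distribution//; exact/measurable_EFinP.
Qed.

End integration.

(** * The shifted plan and its cost *)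

Section wasserstein_theory.
Context {R : realType} {d : nat}.
Local Notation E := 'cV[R]_d.
Local Notation E' := 'rV[R]_d.
Implicit Types (mu nu : probability E R) (pi : probability (E * E)%type R)
  (beta : probability (E * E * E')%type R).

Lemma plan_norm_sqr pi :
  plan_norm pi ^+ 2 = \int[pi]_z sqnorm (z.1 - z.2).
Proof.
by rewrite sqr_sqrtr//; apply: Rintegral_ge0 => z _; exact: sqnorm_ge0.
Qed.

Lemma W2_sqr_le mu nu pi : plan mu nu pi -> W2 mu nu ^+ 2 <= plan_norm pi ^+ 2.
Proof.
(* Squaring preserves the order because both sides are nonnegative; for the infimum this uses that
   [pi] makes the set of costs nonempty. *)
move=> ppi; rewrite lerXn2r ?nnegrE ?sqrtr_ge0//.
  apply: lb_le_inf; first by exists (plan_norm pi), pi.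
  by move=> _ [? _ <-]; exact: sqrtr_ge0.
apply: ge_inf; last by exists pi.
by exists 0 => _ [? _ <-]; exact: sqrtr_ge0.
Qed.

Definition shift_map (c : R) (z : E * E * E') : E * E :=
  (z.1.1 + c *: z.2^T, z.1.2).

Let measurable_shift_map c : measurable_fun setT (shift_map c).
Proof.
apply: measurable_fun_pair; last first.
  exact: (measurableT_comp measurable_snd measurable_fst).
apply: measurable_fun_mx => i j; under eq_fun do rewrite !mxE.
apply: measurable_funD.
  apply: (measurableT_comp (measurable_coord i j)).
  exact: (measurableT_comp measurable_fst measurable_fst).
apply: measurable_funM => //.
exact: (measurableT_comp (measurable_coord j i) measurable_snd).
Qed.
HB.instance Definition _ c :=
  isMeasurableFun.Build _ _ _ _ _ (measurable_shift_map c).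

Lemma measurable_shift1 (c : R) :
  measurable_fun setT (fun z : E * E' => z.1 + c *: z.2^T).
Proof.
apply: measurable_fun_mx => i j; under eq_fun do rewrite !mxE.
apply: measurable_funD.
  exact: (measurableT_comp (measurable_coord i j) measurable_fst).
apply: measurable_funM => //.
exact: (measurableT_comp (measurable_coord j i) measurable_snd).
Qed.

(** The shifted point depends on [(x, q)] only, so its law is determined by
    [push proj13_triple beta], and the shift composed with [dual_map kappa] is the first
    projection. *)
Lemma plan_shift_map mu nue nu pi beta (kappa : R) : kappa != 0 ->
  plan mu nue pi ->
  measure_eq (push proj13_triple beta) (push (dual_map kappa) pi) ->
  measure_eq (push proj2_triple beta) nu ->
  plan mu nu (push (shift_map (kappa ^+ 2)) beta).
Proof.
move=> k0 [pi1 pi2] bg bnu; split; last exact: bnu.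
move=> A mA; rewrite -pi1//.
pose B := (fun z : E * E' => z.1 + kappa ^+ 2 *: z.2^T) @^-1` A.
have mB : measurable B.
  by rewrite -[B]setTI; exact: measurable_shift1.
rewrite [LHS](bg B mB : beta (proj13_triple @^-1` B) = _).
congr (pi _); apply/funext => z; rewrite /B /preimage /= /plan_proj1.
by rewrite linearZ /= trmxK scalerA mulfV ?expf_neq0// scale1r addrC subrK.
Qed.

Lemma W2_sqr_shift_le mu nue nu pi beta (kappa : R) : kappa != 0 ->
  plan mu nue pi -> P2_triple beta ->
  measure_eq (push proj13_triple beta) (push (dual_map kappa) pi) ->
  measure_eq (push proj2_triple beta) nu ->
  W2 mu nu ^+ 2 <= plan_norm pi ^+ 2
    - 2 * kappa ^+ 2 * \int[beta]_z ((z.2 *m (z.1.2 - z.1.1)) ord0 ord0)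
    + plan_norm (push proj12_triple beta) ^+ 2.
Proof.
move=> k0 ppi b2 bg bnu.
apply: (le_trans (W2_sqr_le (plan_shift_map k0 ppi bg bnu))).
have mq : measurable_fun setT (fun z : E * E * E' => sqnorm z.2).
  exact: (measurableT_comp measurable_sqnorm measurable_snd).
have mx : measurable_fun setT (fun z : E * E * E' => z.1.1).
  exact: (measurableT_comp measurable_fst measurable_fst).
have mx' : measurable_fun setT (fun z : E * E * E' => z.1.2).
  exact: (measurableT_comp measurable_snd measurable_fst).
have mxx' : measurable_fun setT (fun z : E * E * E' => sqnorm (z.1.1 - z.1.2)).
  exact: (measurableT_comp measurable_sqnormB measurable_fst).
have mp : measurable_fun setT
    (fun z : E * E * E' => (z.2 *m (z.1.2 - z.1.1)) ord0 ord0).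
  under eq_fun do rewrite mxE; apply: measurable_sum => k.
  under eq_fun do rewrite !mxE; apply: measurable_funM.
    exact: (measurableT_comp (measurable_coord _ _) measurable_snd).
  by apply: measurable_funB; exact: (measurableT_comp (measurable_coord _ _)).
(* The integrand of [P2_triple] dominates, up to a constant, every term in the expansion of the
   cost. *)
pose G (z : E * E * E') := sqnorm z.1.1 + sqnorm z.1.2 + sqnorm z.2.
have mG : measurable_fun setT G.
  by apply: measurable_funD => //; apply: measurable_funD;
     exact: (measurableT_comp measurable_sqnorm).
have G0 z : 0 <= G z by rewrite !addr_ge0 ?sqnorm_ge0.
have iq : beta.-integrable setT (EFin \o (fun z => sqnorm z.2)).
  apply: (@integrable_dominated _ _ _ _ 1 _ G) => // z.
  by rewrite mul1r ger0_norm ?sqnorm_ge0// lerDr addr_ge0 ?sqnorm_ge0.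
have ip : beta.-integrable setT
    (EFin \o (fun z => (z.2 *m (z.1.2 - z.1.1)) ord0 ord0)).
  apply: (@integrable_dominated _ _ _ _ 1 _ G) => // z.
  by rewrite mul1r; exact: normr_pairing_le.
have ixx' : beta.-integrable setT (EFin \o (fun z => sqnorm (z.1.1 - z.1.2))).
  apply: (@integrable_dominated _ _ _ _ 2 _ G) => // z.
  rewrite ger0_norm ?sqnorm_ge0//; apply: (le_trans (sqnormB_le _ _)).
  by rewrite ler_pM2l// lerDl sqnorm_ge0.
(* Under [dual_map kappa] the row [q] is the transposed displacement divided by [kappa ^+ 2], and
   [q] has the same law under [beta]. Hence the [q]-term of the expansion is exactly the cost of
   [pi]. *)
have cost_pi :
    plan_norm pi ^+ 2 = (kappa ^+ 2) ^+ 2 * \int[beta]_z sqnorm z.2.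
  have mq2 : measurable_fun setT
      (fun z : E * E' => (kappa ^+ 2) ^+ 2 * sqnorm z.2).
    apply: measurable_funM => //.
    exact: (measurableT_comp measurable_sqnorm measurable_snd).
  have q20 (z : E * E') : 0 <= (kappa ^+ 2) ^+ 2 * sqnorm z.2.
    by rewrite mulr_ge0 ?sqr_ge0 ?sqnorm_ge0.
  rewrite -RintegralZl// plan_norm_sqr.
  transitivity (\int[pi]_z ((kappa ^+ 2) ^+ 2 * sqnorm (dual_map kappa z).2)).
    apply: eq_Rintegral => z _; rewrite /= sqnormZ sqnorm_tr mulrA -exprMn.
    by rewrite mulfV ?expf_neq0// expr1n mul1r.
  rewrite -(Rintegral_push (dual_map kappa) pi mq2 q20).
  by rewrite -(Rintegral_measure_eq _ bg) Rintegral_push.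
rewrite cost_pi !plan_norm_sqr !Rintegral_push; last 4 first.
- exact: measurable_sqnormB.
- by move=> z; exact: sqnorm_ge0.
- exact: measurable_sqnormB.
- by move=> z; exact: sqnorm_ge0.
under eq_Rintegral do rewrite /= sqnorm_shift.
(* Real-valued integrals are additive only for integrable terms, so each summand is treated
   separately. *)
have iZq : beta.-integrable setT
    (EFin \o (fun z => (kappa ^+ 2) ^+ 2 * sqnorm z.2)).
  exact: (integrableZl measurableT _ iq).
have iZp : beta.-integrable setT
    (EFin \o (fun z => 2 * kappa ^+ 2 * (z.2 *m (z.1.2 - z.1.1)) ord0 ord0)).
  exact: (integrableZl measurableT _ ip).
rewrite RintegralD//; last exact: (integrableB measurableT iZq iZp).
by rewrite RintegralB ?RintegralZl.
Qed.

Lemma P2_dual_push mu nu pi (kappa : R) : P2 mu -> P2 nu -> plan mu nu pi ->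
  P2_dual (push (dual_map kappa) pi).
Proof.
move=> mu2 nu2 [pi1 pi2]; have msq := @measurable_sqnorm R d 1.
have /(_ mu2) sq1 := (finite_second_moment_push msq sqnorm_ge0 pi1).1.
have /(_ nu2) sq2 := (finite_second_moment_push msq sqnorm_ge0 pi2).1.
have m1 : measurable_fun setT (fun z : E * E => sqnorm z.1).
  exact: (measurableT_comp msq measurable_fst).
have m2 : measurable_fun setT (fun z : E * E => sqnorm z.2).
  exact: (measurableT_comp msq measurable_snd).
have m2' : measurable_fun setT (fun z : E * E' => sqnorm z.2).
  exact: (measurableT_comp measurable_sqnorm measurable_snd).
have m1' : measurable_fun setT (fun z : E * E' => sqnorm z.1).
  exact: (measurableT_comp measurable_sqnorm measurable_fst).
have m12 : measurable_fun setT
    (fun z : E * E' => sqnorm z.1 + sqnorm z.2) by exact: measurable_funD.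
have G0 (z : E * E') : 0 <= sqnorm z.1 + sqnorm z.2.
  by rewrite addr_ge0 ?sqnorm_ge0.
apply/(finite_second_moment_push m12 G0 (fun A _ => erefl)).
(* The 1 covers the base point; the rest comes from [sqnormB_le] applied to the displacement scaled
   by [kappa ^- 2]. *)
pose c := 1 + 2 * (kappa ^- 2) ^+ 2.
have c0 : 0 <= c by rewrite addr_ge0// mulr_ge0// sqr_ge0.
rewrite /finite_second_moment; apply: integrable_lty => //.
apply: (@integrable_dominated _ _ _ _ c _
    (fun z : E * E => sqnorm z.1 + sqnorm z.2)) => //.
- exact: (measurableT_comp m12).
- exact: measurable_funD.
- by move=> z; rewrite addr_ge0 ?sqnorm_ge0.
- move=> z; rewrite ger0_norm ?addr_ge0 ?sqnorm_ge0//= sqnormZ sqnorm_tr.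
  have := ler_wpM2l (sqr_ge0 (kappa ^- 2)) (sqnormB_le z.1 z.2).
  by have := sqnorm_ge0 z.1; rewrite /c; lra.
- rewrite /finite_second_moment; under eq_integral do rewrite EFinD.
  rewrite ge0_integralD//; first exact: lte_add_pinfty.
  + by move=> z _; rewrite lee_fin sqnorm_ge0.
  + exact/measurable_EFinP.
  + by move=> z _; rewrite lee_fin sqnorm_ge0.
  + exact/measurable_EFinP.
Qed.

End wasserstein_theory.

(** * From the Ekeland inequality to the proximal inequality *)

Theorem lemma3p7 (R : realType) (d : nat) (T : R)
    (D : set (probability 'cV[R]_d R))
    (phi : R * probability 'cV[R]_d R -> R)
    (s : R) (mu : probability 'cV[R]_d R) (eps kappa : R)
    (te : R) (nue : probability 'cV[R]_d R)
    (pie : probability ('cV[R]_d * 'cV[R]_d)%type R) :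
  let Dom := cylinder T (unit_enlargement D) in
  0 < T ->
  D `<=` P2 -> bounded_for W2 D ->
  UC Dom phi -> has_ubound (abs_values Dom phi) ->
  0 < s < T -> D mu -> 0 < eps -> 0 < kappa ->
  ekeland_pair Dom phi s mu kappa eps te nue ->
  optimal_plan mu nue pie ->
  rho1 Dom phi kappa < Num.min 1 (Num.min s (T - s)) ->
  prox_subdiff T Dom phi eps te nue
    (kappa ^- 2 * (s - te), push (dual_map kappa) pie).
Proof.
move=> Dom T0 D2 Dbd ucphi phibd sT Dmu eps0 kappa0 [Dte ek1 ek2] [ppi opi] rho.
have kn0 : kappa != 0 by rewrite gt_eqF.
have [_ [nue2 _]] := Dte.
split; first exact: P2_dual_push (D2 _ Dmu) nue2 ppi.
(* The radius 1 is an arbitrary choice; [sigma] is the coefficient of the quadratic penalty in the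
   Ekeland pair. *)
exists 1, (2 * kappa ^+ 2)^-1; split=> //.
  by rewrite invr_ge0 mulr_ge0// sqr_ge0.
move=> t nu _ Dtnu beta b2 bg bnu.
have := ek2 t nu Dtnu.
have := W2_sqr_shift_le kn0 ppi b2 bg bnu.
(* Optimality of [pie] identifies its cost with the squared distance from [mu] to [nue] in the
   Ekeland inequality. *)
rewrite opi !real_normK ?num_real//=.
set W := W2 mu nu ^+ 2; set W' := W2 mu nue ^+ 2.
set I := Rintegral _ _ _; set P := plan_norm _ ^+ 2; set S := Num.sqrt _.
set u := kappa ^+ 2.
have u0 : 0 < u by rewrite exprn_gt0.
move=> /(ler_wpM2l (_ : 0 <= (2 * u)^-1)) H1 H2.
(* Scaling by the penalty coefficient gives the pairing integral coefficient 1. *)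
have {}H1 : (2 * u)^-1 * W <= (2 * u)^-1 * (W' + P) - I.
  apply: le_trans (H1 _) _; first by rewrite invr_ge0 mulr_ge0// ltW.
  by rewrite le_eqVlt; apply/orP; left; apply/eqP; field; rewrite gt_eqF.
(* The same expansion in the time variable, where it is an equality; its last square is the time
   part of the [sigma] term. *)
have E : u^-1 * (s - te) * (t - te) = (2 * u)^-1 *
    ((te - s) ^+ 2 - (t - s) ^+ 2 + (t - te) ^+ 2).
  by field; rewrite gt_eqF.
rewrite E; lra.
Qed.
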